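(* Let $G$ be an amenable group, $A$ a finite set, and $\mathcal{F} = (F_j)_{j \in J}$ a Følner net for $G$. Let $X \subset A^G$ be a strongly irreducible subshift. Suppose that $Y \subset A^G$ is a subshift which is strictly contained in $X$. Then $\operatorname{ent}_{\mathcal{F}}(Y) < \operatorname{ent}_{\mathcal{F}}(X)$.
   Context: $A^G$ is the set of all maps $x \colon G \to A$ with the product of the discrete topologies; $G$ acts by $(gx)(h) = x(g^{-1}h)$. A subshift is a closed $G$-invariant subset. For $\Omega \subset G$, $x|_\Omega$ is the restriction and $X_\Omega = \{x|_\Omega : x \in X\} \subset A^\Omega$. For $\Omega,\Delta \subset G$ put $\Omega^{+\Delta} = \{g \in G : g\Delta \cap \Omega \neq \varnothing\} = \Omega\Delta^{-1}$. A subshift $X$ is strongly irreducible if there is a finite $\Delta \subset G$ such that for all finite $\Omega_1,\Omega_2 \subset G$ with $\Omega_1^{+\Delta} \cap \Omega_2 = \varnothing$ and all $x_1,x_2 \in X$ there is $x \in X$ with $x|_{\Omega_1} = x_1|_{\Omega_1}$ and $x|_{\Omega_2} = x_2|_{\Omega_2}$. A Følner net for $G$ is a family $\mathcal{F} = (F_j)_{j\in J}$ of nonempty finite subsets of $G$ indexed by a directed set $J$ such that $\lim_j |F_j^{+E}\setminus F_j|/|F_j| = 0$ for every finite $E \subset G$; $G$ is amenable if it admits one. The entropy of a subset $X \subset A^G$ is $\operatorname{ent}_{\mathcal{F}}(X) = \limsup_j \frac{\log |X_{F_j}|}{|F_j|}$ (with $\log 0 = -\infty$). *)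

(* Defs.v *)
From mathcomp Require Import all_boot all_order all_algebra finmap.
From mathcomp Require Import all_classical all_reals all_analysis.
Import Order.TTheory GRing.Theory Num.Theory.
Import numFieldNormedType.Exports.

Set Implicit Arguments.
Unset Strict Implicit.
Unset Printing Implicit Defensive.

Local Open Scope classical_set_scope.
Local Open Scope ring_scope.

Definition directed_set (d : Order.disp_t) (J : preorderType d) : Prop :=
  [set: J] !=set0 /\ forall i j : J, exists2 k : J, (i <= k)%O & (j <= k)%O.

(* The filter of tails of [J]: limits and limsups along nets indexed by [J]
   are taken along it. *)
Definition tails (d : Order.disp_t) (J : preorderType d) : set_system J :=
  filter_from [set: J] (fun i => [set j | (i <= j)%O]).

Arguments tails {d} J _.

Lemma tails_filter (d : Order.disp_t) (J : preorderType d) :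
  directed_set J -> ProperFilter (tails J).
Proof.
move=> [[i0 _] Jdir]; apply: filter_from_proper; last first.
  by move=> i _; exists i => /=.
apply: filter_from_filter; first by exists i0.
move=> i j _ _; have [k ik jk] := Jdir i j; exists k => // l /= kl.
by split; [exact: le_trans ik kl | exact: le_trans jk kl].
Qed.

(* [limf_esup] asks for a [filteredType] structure on the index type but does
   not use it; the alias [discrete_topology J] provides one. *)
Definition net_limsup (R : realType) (d : Order.disp_t) (J : preorderType d)
    (u : J -> \bar R) : \bar R :=
  limf_esup (u : discrete_topology J -> \bar R) (tails J).

Lemma net_limsupE (R : realType) (d : Order.disp_t) (J : preorderType d)
    (u : J -> \bar R) :
  net_limsup u =
  ereal_inf [set ereal_sup (u @` [set j | (i <= j)%O]) | i in [set: J]].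
Proof.
apply/eqP; rewrite eq_le; apply/andP; split.
  apply: le_ereal_inf_tmp => _ [i _ <-]; apply: ereal_inf_lbound.
  by exists [set j | (i <= j)%O] => //; exists i.
apply: le_ereal_inf_tmp => _ [V [i _ iV] <-]; apply: ge_ereal_inf.
exists (ereal_sup (u @` [set j | (i <= j)%O])); first by exists i.
by apply: ereal_sup_le => _ [j ij <-]; exists j => //; exact: iV.
Qed.

Section subshifts.
Variables (G : groupType) (A : finType).

(* The underlying type is [G -> A]. *)
Definition config : topologicalType :=
  prod_topology (fun _ : G => discrete_topology A).

Definition config_shift (g : G) (x : config) : config := fun h => x (g^-1 * h)%g.

Definition subshift (X : set config) : Prop :=
  closed X /\ forall g x, X x -> X (config_shift g x).

Definition restriction (W : {fset G}) (x : config) : {ffun W -> A} :=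
  [ffun h : W => x (val h)].

Definition patterns (X : set config) (W : {fset G}) : set {ffun W -> A} :=
  restriction W @` X.

(* Omega^{+Delta} = Omega Delta^{-1} *)
Definition thicken (W D : {fset G}) : {fset G} :=
  [fset (w * d^-1)%g | w in W, d in D]%fset.

Lemma thickenP (W D : {fset G}) (g : G) :
  reflect (exists2 d, d \in D & (g * d)%g \in W) (g \in thicken W D).
Proof.
apply: (iffP idP) => [/imfset2P[w /= wW [d /= dD ->]]|[d dD gdW]].
  by exists d => //; rewrite mulgVK.
by apply/imfset2P; exists (g * d)%g => //; exists d => //; rewrite mulgK.
Qed.

Definition strongly_irreducible (X : set config) : Prop :=
  exists D : {fset G}, forall W1 W2 : {fset G},
    (thicken W1 D `&` W2 = fset0)%fset ->
    forall x1 x2 : config, X x1 -> X x2 ->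
    exists x : config, [/\ X x, restriction W1 x = restriction W1 x1
                            & restriction W2 x = restriction W2 x2].

End subshifts.

Arguments patterns {G A} X W _.

Definition folner_net (R : realType) (G : groupType) (d : Order.disp_t)
    (J : preorderType d) (F : J -> {fset G}) : Prop :=
  [/\ directed_set J,
      forall j, F j != fset0 &
      forall E : {fset G},
        (fun j => #|` (thicken (F j) E `\` F j)%fset|%:R / #|` F j|%:R : R)
          @ tails J --> (0 : R)].

Definition amenable (R : realType) (G : groupType) : Prop :=
  exists (d : Order.disp_t) (J : preorderType d) (F : J -> {fset G}),
    folner_net R F.

(* [lne 0 = -oo], so the entropy of the empty set is [-oo]. *)
Definition entropy (R : realType) (G : groupType) (A : finType)
    (d : Order.disp_t) (J : preorderType d) (F : J -> {fset G})
    (X : set (config G A)) : \bar R :=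
  net_limsup (fun j =>
    lne (#|patterns X (F j)|%:R : R)%:E / (#|` F j|%:R : R)%:E)%E.

(* Main.v *)
(** As [Y] is closed, some [x] in [X] has a restriction to a finite [W] that no
    element of [Y] shows, at any position.  Let [K] contain [W] and [W D^-1], [D]
    being a constant of strong irreducibility.  Forbidding [x|_W] at one more
    position of a [K]-separated family multiplies the number of [X]-patterns on a
    finite [F] by at most [M / (M + 1)], with [M = (|A| + 1) ^ |K|], because a
    pattern in which [x|_W] is absent can be overwritten near that position.  A
    Folner set [F] contains the translates of [W] at a [K]-separated family of
    size proportional to [|F|], whence an exponential gap between [|Y_F|] and
    [|X_F|]. *)
Require Import Defs.
From mathcomp Require Import all_boot all_order all_algebra finmap.
From mathcomp Require Import all_classical all_reals all_analysis.
From mathcomp Require Import zify lra.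
Import Order.TTheory GRing.Theory Num.Theory.

Set Implicit Arguments.
Unset Strict Implicit.
Unset Printing Implicit Defensive.

Local Open Scope classical_set_scope.
Local Open Scope group_scope.

(** * Interiors and separated families of finite subsets of a group *)

Section combinatorics.
Variable G : groupType.
Implicit Types (F W D K : {fset G}) (g : G) (s : seq G).

Lemma card_thicken W D : (#|` thicken W D| <= #|` W| * #|` D|)%N.
Proof.
rewrite -(size_allpairs (fun w d => w * d^-1)%g); apply: uniq_leq_size => //.
by move=> _ /imfset2P[w wW [d dD ->]]; apply/allpairsP; exists (w, d).
Qed.

Definition separated K s :=
  {in s &, forall g h, g != h -> {in K &, forall k l, g * k != h * l}}.

Definition inner F W : {fset G} :=
  [fset g in F | [forall w : W, g * val w \in F]]%fset.

Lemma innerP F W g :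
  reflect (g \in F /\ {in W, forall w, g * w \in F}) (g \in inner F W).
Proof.
rewrite !inE; apply: (iffP andP) => -[gF gW]; split => //.
  by move=> w wW; exact: (forallP gW [` wW]%fset).
by apply/forallP => w; rewrite gW ?fsvalP.
Qed.

(** A [g] in [F] outside the inner part has some [g * w] outside [F]; this point lies in the
    boundary of [F], and [w] recovers [g] from it. *)
Lemma card_inner F W :
  (#|` F| <= #|` inner F W|
     + #|` thicken F [fset w^-1 | w in W] `\` F|%fset * #|` W|)%N.
Proof.
apply: leq_trans (leq_add (leqnn _) (card_thicken _ _)).
apply: leq_trans (leq_card_fsetU _ _); apply: fsubset_leq_card.
apply/fsubsetP => g gF; rewrite in_fsetU; apply/orP.
have [gI|gI] := boolP (g \in inner F W); [by left|right].
have : ~ {in W, forall w, g * w \in F}.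
  by move=> gW; move/negP: gI; apply; exact/innerP.
move=> /existsNP[w /not_implyP[wW /negP gwF]].
apply/thickenP; exists w => //; rewrite inE gwF; apply/thickenP.
by exists w^-1; [exact: in_imfset|rewrite mulgK].
Qed.

(** Greedy choice: pick [g] in [S], discard [g K K^-1], which holds every [h] such that [h K] meets
    [g K], and recurse. Each pick discards at most [|K|^2] points, and at least [g] itself as [K] is
    nonempty. *)
Lemma exists_separated K (S : {fset G}) : (0 < #|` K|)%N -> exists s,
  [/\ uniq s, {subset s <= S}, separated K s & #|` S| <= size s * #|` K| ^ 2]%N.
Proof.
move=> K0; have [n] := ubnP #|` S|; elim: n S => // n IHn S.
have [->|/fset0Pn[g gS]] := eqVneq S fset0.
  by exists [::]; split=> //; rewrite cardfs0.
rewrite ltnS => Sn; pose N := thicken [fset g * k | k in K]%fset K.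
have NP h k l : k \in K -> l \in K -> g * k = h * l -> h \in N.
  by move=> kK lK gkhl; apply/thickenP; exists l => //; rewrite -gkhl in_imfset.
have gN : g \in N.
  by move: K0; rewrite cardfs_gt0 => /fset0Pn[k kK]; exact: (NP _ k k).
have SN : (#|` S `\` N|%fset < #|` S|)%N.
  apply: fproper_ltn_card; rewrite fproperE fsubDset fsubsetUr /=.
  by apply/negP => /fsubsetP/(_ g gS); rewrite inE gN.
have [s [us sS sK ss]] := IHn (S `\` N)%fset (leq_trans SN Sn).
exists (g :: s); split.
- by rewrite /= us andbT; apply/negP => /sS; rewrite inE gN.
- by move=> h; rewrite inE => /predU1P[->//|/sS]; rewrite inE => /andP[].
- have gs h k l : h \in s -> k \in K -> l \in K -> g * k != h * l.
    move=> /sS; rewrite inE => /andP[hN _] kK lK.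
    by apply: contra hN => /eqP; exact: NP.
  move=> h h'; rewrite !inE => /predU1P[->|hs] /predU1P[->|h's].
  + by rewrite eqxx.
  + by move=> _ k l kK lK; exact: gs.
  + by move=> _ k l kK lK; rewrite eq_sym; exact: gs.
  + exact: sK.
- rewrite /= mulSn addnC; apply: leq_trans (leq_add ss (leqnn _)).
  apply: (@leq_trans (#|` S `\` N|%fset + #|` N|)).
    apply: leq_trans (leq_card_fsetU _ _); apply: fsubset_leq_card.
    by apply/fsubsetP => h hS; rewrite !inE hS andbT orNb.
  rewrite leq_add2l; apply: leq_trans (card_thicken _ _) _.
  by rewrite expnS expn1 leq_mul2r leq_imfset_card orbT.
Qed.

End combinatorics.

(** * Counting the patterns of a strongly irreducible subshift *)

Section patterns.
Variables (G : groupType) (A : finType).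
Implicit Types (X Y : set (config G A)) (W : {fset G}).

Lemma restrictionP W (x y : config G A) :
  restriction W x = restriction W y <-> {in W, x =1 y}.
Proof.
split=> [/ffunP xy h hW|xy]; first by have := xy [` hW]%fset; rewrite !ffunE.
by apply/ffunP => h; rewrite !ffunE xy// fsvalP.
Qed.

(** The cylinders around [x] generate a filter converging to [x] in the product topology, so one of
    them lies in the open complement of [Y]. *)
Lemma closed_restriction Y (x : config G A) : closed Y -> ~ Y x ->
  exists W : {fset G}, forall y, Y y -> restriction W y <> restriction W x.
Proof.
move=> Yclosed Yx; pose B W := [set y | restriction W y = restriction W x].
have Bfilter : Filter (filter_from [set: {fset G}] B).
  apply: filter_from_filter; first by exists fset0.
  move=> V W _ _; exists (V `|` W)%fset => // y /restrictionP xy.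
  by split; apply/restrictionP => h hW; rewrite xy// inE hW ?orbT.
have : filter_from [set: {fset G}] B --> x.
  apply/cvg_sup => g U [_ [[V oV <-] Vxg] VU].
  exists [fset g]%fset => // y /restrictionP xy; apply: VU => /=.
  by rewrite xy ?inE.
move=> /(_ (~` Y)) [|W _ BY].
  by apply: open_nbhs_nbhs; split; [exact: closed_openC|].
by exists W => y Yy yx; exact: (BY y).
Qed.

Definition occurs W (x y : config G A) g := {in W, forall w, y (g * w) = x w}.

(** One extension [y] is enough: when [g W] lies in [F] for all [g] in [s], the pattern alone
    decides the occurrences at [s]. *)
Definition avoiding X (F W : {fset G}) (x : config G A) (s : seq G) :
    {set {ffun F -> A}} :=
  [set q | `[< exists y, [/\ X y, restriction F y = q &
                              {in s, forall g, ~ occurs W x y g}] >]].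

Lemma avoidingP X F W x s q :
  reflect (exists y, [/\ X y, restriction F y = q &
                         {in s, forall g, ~ occurs W x y g}])
          (q \in avoiding X F W x s).
Proof. by rewrite inE; exact: asboolP. Qed.

Definition irreducible_constant X (D : {fset G}) : Prop :=
  forall W1 W2 : {fset G}, (thicken W1 D `&` W2 = fset0)%fset ->
  forall x1 x2, X x1 -> X x2 -> exists y,
  [/\ X y, restriction W1 y = restriction W1 x1 &
           restriction W2 y = restriction W2 x2].

(* Overwriting [y] by a translate of [x] on [g W] alters it inside [g K] only, so
   it sends a pattern of the left-hand set to one that occurs at [g] but still
   not at [s]; the new pattern and the erased values on [g K] (an [option], as
   [g K] may leave [F]) determine the old one. *)
Lemma card_avoiding_cons X (D F W K : {fset G}) (x : config G A) g s :
  irreducible_constant X D ->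
  (forall h y, X y -> X (config_shift h y)) -> X x ->
  (W `<=` K)%fset -> (thicken W D `<=` K)%fset ->
  uniq (g :: s) -> separated K (g :: s) -> {subset g :: s <= inner F W} ->
  (#|avoiding X F W x s| <=
   #|avoiding X F W x s :\: avoiding X F W x (g :: s)| * (#|A|.+1 ^ #|` K|))%N.
Proof.
move=> Xirr Xshift Xx WK WDK /andP[gs us] sepK sF.
set S := avoiding _ _ _ _ s; set S' := _ :\: _.
pose gK := [fset g * k | k in K]%fset.
have /choice[phi phiP] (q : {ffun F -> A}) : exists q', q \in S ->
    q' \in S' /\ forall h : F, val h \notin gK -> q' h = q h.
  have [/avoidingP[y [Xy <- ys]]|] := boolP (q \in S); last by exists q.
  (* The two windows are far enough apart because [g W D^-1] lies in [gK]. *)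
  have [|z [Xz zx zy]] := Xirr [fset g * w | w in W]%fset (F `\` gK)%fset _
      (config_shift g x) y (Xshift _ _ Xx) Xy.
    apply/eqP; rewrite fsetI_eq0; apply/fdisjointP => h.
    move=> /thickenP[d dD] /imfsetP[w /= wW hdgw]; rewrite !inE negb_and negbK.
    apply/orP; left; apply/imfsetP; exists (g^-1 * h) => /=; last by rewrite mulVKg.
    apply: (fsubsetP WDK); apply/thickenP; exists d => //.
    by rewrite -mulgA hdgw mulKg.
  move/restrictionP : zx => zx; move/restrictionP : zy => zy.
  exists (restriction F z) => _; split; last first.
    by move=> h hK; rewrite !ffunE zy// inE hK fsvalP.
  have gz : occurs W x z g.
    by move=> w wW; rewrite zx ?in_imfset//= /config_shift mulKg.
  rewrite inE; apply/andP; split.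
    (* Every extension of the new pattern shows [x|_W] at [g], as [g W] lies in [F]. *)
    apply/avoidingP => -[z' [_ /restrictionP z'z /(_ g)]]; apply.
      by rewrite inE eqxx.
    move=> w wW; rewrite z'z ?gz//.
    by have /innerP[_] := sF g (mem_head _ _); apply.
  (* For [h] in [s], [h W] lies in [F] and misses [gK] by separation, so [z] and [y] agree there. *)
  apply/avoidingP; exists z; split => // h hs hz; apply: (ys h hs) => w wW.
  rewrite -hz// zy// inE; apply/andP; split; last first.
    by have /innerP[_] := sF h (mem_behead (hs : h \in behead (g :: s))); apply.
  apply/imfsetP => -[k /= kK /eqP]; apply/negP; apply: sepK => //.
  - by rewrite inE hs orbT.
  - by rewrite mem_head.
  - by apply: contraNneq gs => <-.
  - exact: (fsubsetP WK).
pose look (q : {ffun F -> A}) (h : G) : option A := omap q (insub h).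
pose psi q := (phi q, [ffun k : K => look q (g * val k)]).
have psi_inj : {in S &, injective psi}.
  move=> q r qS rS [qr /ffunP qrK]; apply/ffunP => h.
  have [/imfsetP[k /= kK hgk]|hK] := boolP (val h \in gK).
    have := qrK [` kK]%fset; rewrite !ffunE /= -hgk /look valK /=.
    by case.
  by have [_ <-//] := phiP q qS; have [_ <-//] := phiP r rS; rewrite qr.
rewrite -(card_in_imset psi_inj).
have -> : (#|A|.+1 ^ #|` K| = #|[set: {ffun K -> option A}]%SET|)%N.
  by rewrite cardsT card_ffun card_option cardfE.
rewrite -cardsX; apply: subset_leq_card; apply/fintype.subsetP => _ /imsetP[q qS ->].
by rewrite finset.in_setX finset.in_setT andbT; have [] := phiP q qS.
Qed.

Lemma card_avoiding X (D F W K : {fset G}) (x : config G A) s :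
  irreducible_constant X D ->
  (forall h y, X y -> X (config_shift h y)) -> X x ->
  (W `<=` K)%fset -> (thicken W D `<=` K)%fset ->
  uniq s -> separated K s -> {subset s <= inner F W} ->
  (#|avoiding X F W x s| * (#|A|.+1 ^ #|` K|).+1 ^ size s <=
   #|patterns X F| * (#|A|.+1 ^ #|` K|) ^ size s)%N.
Proof.
move=> Xirr Xshift Xx WK WDK us sK sF; set M := (#|A|.+1 ^ _)%N.
elim: s us sK sF => [|g s IHs] us sK sF.
  rewrite !expn0 !muln1; apply: subset_leq_card; apply/fintype.subsetP => q.
  by move=> /avoidingP[y [Xy <- _]]; rewrite inE; exists y.
have step := card_avoiding_cons Xirr Xshift Xx WK WDK us sK sF.
have {}IHs : (#|avoiding X F W x s| * M.+1 ^ size s <=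
              #|patterns X F| * M ^ size s)%N.
  apply: IHs.
  - by case/andP: us.
  - by move=> h h' hs h's; apply: sK; rewrite inE ?hs ?h's orbT.
  - by move=> h hs; apply: sF; rewrite inE hs orbT.
have sub : avoiding X F W x (g :: s) \subset avoiding X F W x s.
  apply/fintype.subsetP => q /avoidingP[y [Xy yq ys]]; apply/avoidingP.
  by exists y; split => // h hs; apply: ys; rewrite inE hs orbT.
rewrite -/M cardsDS// in step; move/subset_leq_card : sub => ba.
(* With [b <= a] the two counts, [a <= (a - b) M] gives [b M + b <= b M + a <= a M]. *)
have {}step : (#|avoiding X F W x (g :: s)| * M.+1 <=
                   #|avoiding X F W x s| * M)%N.
  have M0 : (0 < M)%N by rewrite expn_gt0.
  nia.
rewrite /= !expnS mulnA (leq_trans (leq_mul step (leqnn _)))//.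
by rewrite -mulnA mulnCA [leqRHS]mulnCA leq_mul2l IHs orbT.
Qed.

(** Here [n] counts the separated positions found in [F]. That [E], [M] and [N] are uniform in [F]
    lets the gap survive the limit. *)
Lemma card_patterns_gap X Y :
  subshift X -> strongly_irreducible X -> subshift Y -> Y `<` X ->
  exists (E : {fset G}) (M N : nat), [/\ 0 < M, 0 < N &
    forall F : {fset G}, exists n : nat,
    #|` F| <= N * (n + #|` thicken F E `\` F|%fset) /\
    #|patterns Y F| * M.+1 ^ n <= #|patterns X F| * M ^ n]%N.
Proof.
move=> [_ Xshift] [D Xirr] [Yclosed Yshift] [YX /existsNP[x /not_implyP[Xx Yx]]].
have [W YW] := closed_restriction Yclosed Yx.
(* The point [1] keeps [K] nonempty even for an empty [W], which may arise when [Y] is empty. *)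
pose K := (1%g |` (W `|` thicken W D))%fset.
have WK : (W `<=` K)%fset by apply/fsubsetP => w wW; rewrite !inE wW orbT.
have WDK : (thicken W D `<=` K)%fset.
  by apply/fsubsetP => w wW; rewrite !inE wW !orbT.
have K0 : (0 < #|` K|)%N.
  by rewrite cardfs_gt0; apply/fset0Pn; exists 1%g; rewrite !inE eqxx.
exists [fset w^-1 | w in W]%fset, (#|A|.+1 ^ #|` K|)%N, (#|` K| ^ 2)%N.
split=> [||F]; rewrite ?expn_gt0 ?K0//.
have [s [us sF sK Fs]] := exists_separated (inner F W) K0.
exists (size s); split.
  (* Since [|W| <= |K| <= |K|^2], the same constant bounds the boundary term. *)
  rewrite mulnDr mulnC; apply: leq_trans (card_inner F W) (leq_add Fs _).
  rewrite mulnC leq_mul2r; apply/orP; right.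
  apply: leq_trans (fsubset_leq_card WK) _.
  by rewrite -[leqLHS]expn1 leq_pexp2l.
apply: leq_trans (card_avoiding Xirr Xshift Xx WK WDK us sK sF).
rewrite leq_mul2r; apply/orP; right.
apply: subset_leq_card; apply/fintype.subsetP => q; rewrite inE => -[y Yy <-].
apply/avoidingP; exists y; split=> //; first exact: YX.
(* An occurrence at [g] would make a shift of [y], again in [Y], agree with [x] on [W]. *)
move=> g gs yg; apply: (YW (config_shift g^-1 y)); first exact: Yshift.
by apply/restrictionP => w wW; rewrite /config_shift invgK yg.
Qed.

End patterns.

(** * Strict inequality between limsups along a net *)

Section net_limsup.
Local Open Scope ring_scope.
Local Open Scope ereal_scope.
Variables (R : realType) (d : Order.disp_t) (J : preorderType d).
Implicit Types u v : J -> \bar R.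

(** The bounds on [v] make its limsup finite; at an infinite value, adding [b] would yield nothing
    strict. The values of [u] may be [-oo]. *)
Lemma net_limsup_gap u v (b c : R) : directed_set J ->
  (0 < b)%R -> (\forall j \near tails J, u j + b%:E <= v j) ->
  (forall j, 0 <= v j <= c%:E) -> net_limsup u < net_limsup v.
Proof.
move=> [[j0 _] Jdir] b0 [i0 _ uv] vc.
have sup_ge0 i : 0 <= ereal_sup (v @` [set j | (i <= j)%O]).
  have /andP[v0 _] := vc i; apply: le_trans v0 _.
  by apply: ereal_sup_ubound; exists i => /=.
have uvb : net_limsup u + b%:E <= net_limsup v.
  rewrite [leRHS]net_limsupE; apply: le_ereal_inf_tmp => _ [i _ <-].
  have [k ik i0k] := Jdir i i0.
  rewrite -leeBrDr// net_limsupE; apply: ge_ereal_inf.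
  exists (ereal_sup (u @` [set j | (k <= j)%O])); first by exists k.
  apply: ge_ereal_sup => _ [j kj <-].
  rewrite leeBrDr//; apply: le_trans (uv j (le_trans i0k kj)) _.
  by apply: ereal_sup_ubound; exists j => //=; exact: le_trans ik kj.
have vfin : net_limsup v \is a fin_num.
  rewrite fin_numElt; apply/andP; split.
    apply: (@lt_le_trans _ _ 0); first exact: ltNy0.
    by rewrite net_limsupE; apply: le_ereal_inf_tmp => _ [i _ <-].
  apply: (@le_lt_trans _ _ c%:E); last exact: ltry.
  rewrite net_limsupE; apply: ge_ereal_inf.
  exists (ereal_sup (v @` [set j | (j0 <= j)%O])); first by exists j0.
  by apply: ge_ereal_sup => _ [j _ <-]; have /andP[] := vc j.
apply: (@le_lt_trans _ _ (net_limsup v - b%:E)); first by rewrite leeBrDr.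
by rewrite lteBlDr// lteDl// lte_fin.
Qed.

End net_limsup.

(** * From pattern counts to normalised logarithms *)

Section entropy_gap.
Local Open Scope ring_scope.
Variable R : realType.

Lemma lne_div_nat (m n : nat) : (0 < m)%N -> (0 < n)%N ->
  (lne (m%:R : R)%:E / (n%:R : R)%:E)%E = (ln (m%:R : R) / n%:R)%:E.
Proof.
by move=> m0 n0; rewrite lne_EFin ?ltr0n// inver pnatr_eq0 gtn_eqF// EFinM.
Qed.

(** The bound on [t / f] gives [N t <= f / 2], whence [f <= 2 N n]; each of the [n] factors
    contributes [ln (M + 1) - ln M]. *)
Lemma lne_div_nat_gap (y x f M N n t : nat) :
  (0 < x)%N -> (0 < f)%N -> (0 < M)%N -> (0 < N)%N ->
  (y * M.+1 ^ n <= x * M ^ n)%N -> (f <= N * (n + t))%N ->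
  t%:R / f%:R <= (2 * N%:R)^-1 :> R ->
  (lne (y%:R : R)%:E / (f%:R : R)%:E
     + ((ln M.+1%:R - ln M%:R) / (2 * N%:R))%:E
   <= lne (x%:R : R)%:E / (f%:R : R)%:E)%E.
Proof.
move=> x0 f0 M0 N0 yx fnt tf.
have f0' : 0 < f%:R :> R by rewrite ltr0n.
have N0' : 0 < N%:R :> R by rewrite ltr0n.
have M0' : 0 < M%:R :> R by rewrite ltr0n.
(* For [y = 0] the convention [lne 0 = -oo] makes the left-hand side [-oo]. *)
have [->|] := posnP y.
  rewrite le0_lneNy// inver pnatr_eq0 gtn_eqF//.
  by rewrite gt0_mulNye ?lte_fin ?invr_gt0// addNye leNye.
move=> y0; rewrite !lne_div_nat// -EFinD lee_fin.
have y0' : 0 < y%:R :> R by rewrite ltr0n.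
have x0' : 0 < x%:R :> R by rewrite ltr0n.
set b := ln _ - ln _.
have b0 : 0 <= b by rewrite subr_ge0 ler_ln ?posrE ?ltr0n// ler_nat.
have nb : ln y%:R + n%:R * b <= ln x%:R.
  have : (y * M.+1 ^ n)%:R <= (x * M ^ n)%:R :> R by rewrite ler_nat.
  rewrite !natrM !natrX -ler_ln ?posrE ?mulr_gt0 ?exprn_gt0 ?ltr0n//.
  rewrite !lnM ?posrE ?exprn_gt0 ?ltr0n// !lnXn ?ltr0n// -!(mulr_natl (ln _)).
  by rewrite /b mulrBr addrA lerBlDr.
have nf : f%:R <= 2 * N%:R * n%:R :> R.
  have : f%:R <= N%:R * (n%:R + t%:R) :> R by rewrite -natrD -natrM ler_nat.
  move: tf; rewrite ler_pdivrMr// mulrC ler_pdivlMr ?mulr_gt0//; lra.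
rewrite ler_pdivlMr// mulrDl divfK ?gt_eqF//.
apply: le_trans nb; rewrite lerD2l mulrAC ler_pdivrMr ?mulr_gt0//; nra.
Qed.

End entropy_gap.

Theorem proposition4p2 (R : realType) (G : groupType) (A : finType)
  (d : Order.disp_t) (J : preorderType d) (F : J -> {fset G})
  (X Y : set (config G A)) :
  amenable R G ->
  folner_net R F ->
  subshift X ->
  strongly_irreducible X ->
  subshift Y ->
  (Y `<` X)%classic ->
  (entropy R F Y < entropy R F X)%E.
Proof.
move=> _ [Jdir F0 FF] Xsub Xirr Ysub YX.
have [E [M [N [M0 N0 gap]]]] := card_patterns_gap Xsub Xirr Ysub YX.
have [x Xx] : X !=set0 by have [_ /existsNP[x /not_implyP[Xx _]]] := YX; exists x.
have f0 j : (0 < #|` F j|)%N by rewrite cardfs_gt0.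
have X0 j : (0 < #|patterns X (F j)|)%N.
  by apply/card_gt0P; exists (restriction (F j) x); rewrite inE; exists x.
have XA j : (#|patterns X (F j)| <= #|A| ^ #|` F j|)%N.
  by apply: leq_trans (max_card _) _; rewrite card_ffun cardfE.
have A0 : (0 < #|A|)%N by apply/card_gt0P; exists (x 1%g).
apply: (@net_limsup_gap _ _ _ _ _
    ((ln M.+1%:R - ln M%:R) / (2 * N%:R))%R (ln #|A|%:R)%R Jdir).
- by rewrite divr_gt0 ?mulr_gt0 ?ltr0n// subr_gt0 ltr_ln ?posrE ?ltr0n ?ltr_nat.
(* The Folner condition for [E] is used with the tolerance [1 / (2 N)] that [lne_div_nat_gap] asks
   for. *)
- have e0 : (0 < (2 * N%:R)^-1 :> R)%R by rewrite invr_gt0 mulr_gt0 ?ltr0n.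
  have := tails_filter Jdir => tailsF.
  have /cvgr0_norm_le/(_ _ e0) := FF E.
  apply: filterS => j; rewrite ger0_norm ?divr_ge0// => tf.
  have [n [fn yx]] := gap (F j).
  exact: (lne_div_nat_gap _ _ _ _ yx fn tf).
(* The bounds [0] and [ln |A|] come from [1 <= |X_F| <= |A|^|F|]. *)
- move=> j; rewrite lne_div_nat// !lee_fin; apply/andP; split.
    by rewrite divr_ge0// ln_ge0// ler1n.
  rewrite ler_pdivrMr ?ltr0n// mulrC mulr_natl -lnXn ?ltr0n// -natrX.
  by rewrite ler_ln ?posrE ?ltr0n ?expn_gt0 ?A0// ler_nat.
Qed.
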